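(* Let $\mathbb{K}$ be a field and $r\in\mathbb{K}$ invertible, $q:=r-1$. For each partition diagram $\pi$ let $$\kappa^{(q)}_\pi:=\sum_{\sigma\le\pi}(-1)^{l(\sigma)-l(\pi)}r^{-l(\sigma)}H_\sigma\in\mathrm{ParSym}.$$ Then for every partition diagram $\pi$, $$H_\pi=r^{l(\pi)}\sum_{\sigma\le\pi}\kappa^{(q)}_\sigma.$$
   Context: **Partition diagrams.** A partition diagram of order $k\ge 0$ is a set partition of $\{1,\dots,k,1',\dots,k'\}$; for $k=0$ the only one is the empty diagram $\emptyset$. For $\pi$ of order $k$ and $\rho$ of order $m$, $\pi\otimes\rho$ is the diagram of order $k+m$ whose blocks are the blocks of $\pi$ and the blocks of $\rho$ with labels shifted by $k$ ($i\mapsto i+k$, $i'\mapsto (i+k)'$). If $k,m\ge1$, $\pi\bullet\rho$ is obtained from $\pi\otimes\rho$ by merging the block containing $k'$ with the block containing $(k+1)'$. The empty diagram is the unit for both operations. A diagram is $\otimes$-irreducible (resp. $\bullet$-irreducible) if it is not $\rho\otimes\sigma$ (resp. $\rho\bullet\sigma$) with $\rho,\sigma$ both non-empty. Every non-empty $\pi$ is uniquely $\pi_1\otimes\cdots\otimes\pi_l$ with all $\pi_i$ non-empty and $\otimes$-irreducible; $l(\pi):=l$, and $l(\emptyset):=0$. **Refinement.** Every non-empty $\pi$ can be uniquely written $\pi=\pi_1\divideontimes_1\pi_2\divideontimes_2\cdots\divideontimes_{n-1}\pi_n$ with each $\divideontimes_i\in\{\otimes,\bullet\}$ and each $\pi_i$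 non-empty and both $\otimes$- and $\bullet$-irreducible (on non-empty diagrams $\otimes$ and $\bullet$ associate with each other). Put $S(\pi)=\{i\in\{1,\dots,n-1\}:\divideontimes_i=\otimes\}$. For non-empty $\pi,\sigma$ write $\pi\sim\sigma$ if their sequences $(\pi_1,\dots,\pi_n)$ and $(\sigma_1,\dots,\sigma_m)$ are equal; $\pi\le\sigma$ if $\pi\sim\sigma$ and $S(\sigma)\subseteq S(\pi)$. The empty diagram is related only to itself, with $\emptyset\le\emptyset$. **ParSym** is the $\mathbb{K}$-vector space with basis $\{H_\pi\}$ indexed by all partition diagrams. *)

(* Defs.v *)
From HB Require Import structures.
From mathcomp Require Import all_boot all_order all_algebra.

Set Implicit Arguments.
Unset Strict Implicit.
Unset Printing Implicit Defensive.

Section Merge.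
Context {T : finType}.
Local Open Scope set_scope.
Implicit Types (P : {set {set T}}) (D : {set T}) (x y : T).

Definition merge_blocks P x y : {set {set T}} :=
  (pblock P x :|: pblock P y) |: (P :\ pblock P x :\ pblock P y).

Lemma merge_blocks_partition P D x y : partition P D -> x \in D -> y \in D ->
  partition (merge_blocks P x y) D.
Proof.
move=> partP xD yD.
have covP := cover_partition partP.
have tiP := partition_trivIset partP.
have Bx : pblock P x \in P by rewrite pblock_mem ?covP.
have By : pblock P y \in P by rewrite pblock_mem ?covP.
have xx : x \in pblock P x by rewrite mem_pblock covP.
have nzB : pblock P x :|: pblock P y != set0.
  by apply/set0Pn; exists x; rewrite inE xx.
have [eqB|neB] := eqVneq (pblock P x) (pblock P y).
  have := partition_neq0 partP By.
  rewrite /merge_blocks eqB setUid => nz.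
  have -> : P :\ pblock P y :\ pblock P y = P :\ pblock P y.
    by apply/setP=> B; rewrite !inE; case: (B == _).
  by rewrite setD1K.
have part2 : partition (P :\ pblock P x :\ pblock P y)
    (D :\: pblock P x :\: pblock P y).
  apply: partitionD1; first exact: partitionD1.
  by rewrite !inE eq_sym neB By.
have sub : pblock P x :|: pblock P y \subset D.
  by rewrite subUset !(partitionS partP).
have dis : [disjoint pblock P x :|: pblock P y
                   & D :\: pblock P x :\: pblock P y].
  by rewrite -setI_eq0 setDDl setIDA setDIl setDv set0I.
have -> : D = (pblock P x :|: pblock P y) :|: (D :\: pblock P x :\: pblock P y).
  by rewrite setDDl -{1}(setID D (pblock P x :|: pblock P y)) (setIidPr sub).
exact: partitionU1 part2 nzB dis.
Qed.

End Merge.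

(* The labels 1, .., k are [inl i] and the labels 1', .., k' are [inr i], with
   i : 'I_k counted from 0. *)
Definition dgm_of (k : nat) :=
  {P : {set {set ('I_k + 'I_k)%type}} | partition P [set: ('I_k + 'I_k)%type]%SET}.

Definition pdiag := {k : nat & dgm_of k}.

Section Operations.
Local Open Scope set_scope.

Lemma pd0_subproof :
  partition (set0 : {set {set ('I_0 + 'I_0)%type}}) [set: ('I_0 + 'I_0)%type].
Proof.
have -> : [set: ('I_0 + 'I_0)%type] = set0 by apply/setP=> [[[]|[]]].
by rewrite partition_set0.
Qed.

Definition pd0 : pdiag := Tagged dgm_of (exist _ set0 pd0_subproof : dgm_of 0).

Definition lemb {k} m (x : 'I_k + 'I_k) : 'I_(k + m) + 'I_(k + m) :=
  match x with inl i => inl (lshift m i) | inr i => inr (lshift m i) end.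
Definition remb k {m} (x : 'I_m + 'I_m) : 'I_(k + m) + 'I_(k + m) :=
  match x with inl i => inl (rshift k i) | inr i => inr (rshift k i) end.

Definition tens_blocks k m (P : {set {set ('I_k + 'I_k)%type}})
    (Q : {set {set ('I_m + 'I_m)%type}}) :
    {set {set ('I_(k + m) + 'I_(k + m))%type}} :=
  [set lemb m @: (B : {set _}) | B in P] :|: [set remb k @: (B : {set _}) | B in Q].

Lemma tens_blocks_partition k m P Q :
  partition P [set: ('I_k + 'I_k)%type] ->
  partition Q [set: ('I_m + 'I_m)%type] ->
  partition (tens_blocks P Q) [set: ('I_(k + m) + 'I_(k + m))%type].
Proof.
move=> partP partQ.
have linj : injective (@lemb k m).
  by move=> [i|i] [j|j] //= [] /eqP; rewrite ?eqn_add2l => /eqP/val_inj ->.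
have rinj : injective (@remb k m).
  by move=> [i|i] [j|j] //= [] /eqP; rewrite ?eqn_add2l => /eqP/val_inj ->.
have lrneq x y : lemb m x != remb k y :> ('I_(k + m) + 'I_(k + m))%type.
  apply/eqP; case: x y => i [j|j] //= [] ij.
    by have := ltn_ord i; rewrite ij ltnNge leq_addr.
  by have := ltn_ord i; rewrite ij ltnNge leq_addr.
have [partl partr] : partition [set lemb m @: (B : {set _}) | B in P] (lemb m @: setT)
    /\ partition [set remb k @: (B : {set _}) | B in Q] (remb k @: setT).
  by rewrite !imset_partition.
apply/and3P; split.
- rewrite /tens_blocks /cover finset.bigcup_setU -/(cover _) -/(cover _).
  rewrite (cover_partition partl) (cover_partition partr).
  apply/eqP/setP=> x; rewrite !inE.
  case: x => i; rewrite -(splitK i); case: (split i) => j /=; apply/orP.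
  + by left; apply/imsetP; exists (inl j).
  + by right; apply/imsetP; exists (inl j).
  + by left; apply/imsetP; exists (inr j).
  + by right; apply/imsetP; exists (inr j).
- apply: trivIsetU; [exact: partition_trivIset partl|
                     exact: partition_trivIset partr|].
  rewrite (cover_partition partl) (cover_partition partr).
  rewrite -setI_eq0; apply/eqP/setP=> z; rewrite !inE.
  apply/negP=> /andP[/imsetP[x _ ->] /imsetP[y _ /eqP]].
  by rewrite (negbTE (lrneq _ _)).
- by rewrite inE (partition0 partl) (partition0 partr).
Qed.

Definition pd_tens (p q : pdiag) : pdiag :=
  let: existT k P := p in let: existT m Q := q in
  Tagged dgm_of (exist _ (tens_blocks (val P) (val Q))
    (tens_blocks_partition (valP P) (valP Q)) : dgm_of (k + m)).

Definition bullet_blocks k m (P : {set {set ('I_k.+1 + 'I_k.+1)%type}})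
    (Q : {set {set ('I_m.+1 + 'I_m.+1)%type}}) :
    {set {set ('I_(k.+1 + m.+1) + 'I_(k.+1 + m.+1))%type}} :=
  merge_blocks (tens_blocks P Q)
    (inr (lshift m.+1 ord_max)) (inr (rshift k.+1 ord0)).

Lemma bullet_blocks_partition k m P Q :
  partition P [set: ('I_k.+1 + 'I_k.+1)%type] ->
  partition Q [set: ('I_m.+1 + 'I_m.+1)%type] ->
  partition (bullet_blocks P Q)
    [set: ('I_(k.+1 + m.+1) + 'I_(k.+1 + m.+1))%type].
Proof.
by move=> pP pQ; apply: merge_blocks_partition => //; exact: tens_blocks_partition.
Qed.

Definition pd_bullet (p q : pdiag) : pdiag :=
  match p, q with
  | existT 0 _, _ => q
  | _, existT 0 _ => p
  | existT k.+1 P, existT m.+1 Q =>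
      Tagged dgm_of (exist _ (bullet_blocks (val P) (val Q))
        (bullet_blocks_partition (valP P) (valP Q)) : dgm_of (k.+1 + m.+1))
  end.

End Operations.

(* Imported only here because the set partitions of classical_sets shadow those
   of finset. *)
From mathcomp Require Import boolp classical_sets fsbigop.
From mathcomp Require Import monalg.

Definition tens_irreducible (p : pdiag) : Prop :=
  ~ exists r s : pdiag, [/\ r <> pd0, s <> pd0 & p = pd_tens r s].

Definition bullet_irreducible (p : pdiag) : Prop :=
  ~ exists r s : pdiag, [/\ r <> pd0, s <> pd0 & p = pd_bullet r s].

Local Open Scope classical_set_scope.

Definition is_tens_factorization (p : pdiag) (s : seq pdiag) : Prop :=
  (forall f, f \in s -> f <> pd0 /\ tens_irreducible f) /\
  p = foldr pd_tens pd0 s.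

(* The unique such factorization, selected by choice; likewise [refinement]. *)
Definition tens_factors (p : pdiag) : seq pdiag :=
  xget [::] [set s | is_tens_factorization p s].

Definition pd_length (p : pdiag) : nat := size (tens_factors p).

(* A mixed product p_1 *_1 p_2 *_2 .. *_(n-1) p_n is encoded as
   (p_1, [:: (b_1, p_2); ..; (b_(n-1), p_n)]), where b_i is true when *_i is
   the tensor product and false when it is the bullet product. *)
Definition mixed_product := (pdiag * seq (bool * pdiag))%type.

Definition mixed_factors (w : mixed_product) : seq pdiag :=
  w.1 :: [seq bq.2 | bq <- w.2].

Definition mixed_eval (w : mixed_product) : pdiag :=
  foldl (fun p bq => if bq.1 then pd_tens p bq.2 else pd_bullet p bq.2)
    w.1 w.2.

Definition is_refinement (p : pdiag) (w : mixed_product) : Prop :=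
  (forall f, f \in mixed_factors w ->
     [/\ f <> pd0, tens_irreducible f & bullet_irreducible f]) /\
  p = mixed_eval w.

Definition refinement (p : pdiag) : mixed_product :=
  xget (pd0, [::]) [set w | is_refinement p w].

Definition tens_positions (p : pdiag) : set nat :=
  let ops := [seq bq.1 | bq <- (refinement p).2] in
  [set i | (1 <= i <= size ops)%N /\ nth false ops i.-1].

Definition pd_sim (p q : pdiag) : Prop :=
  mixed_factors (refinement p) = mixed_factors (refinement q).

(* [pd_sim] and [tens_positions] are meaningful on non-empty diagrams only. *)
Definition pd_le (p q : pdiag) : Prop :=
  (p = pd0 /\ q = pd0) \/
  [/\ p <> pd0, q <> pd0, pd_sim p q & tens_positions q `<=` tens_positions p].

Local Open Scope ring_scope.

Notation parsym K := {malg K[pdiag]}.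

Definition Hbasis (K : fieldType) (p : pdiag) : parsym K := << p >>.

(* The exponent of -1 is an integer. The set of the s below p is finite since
   equivalent diagrams have the same order, hence the sum is not truncated. *)
Definition kappa (K : fieldType) (q : K) (p : pdiag) : parsym K :=
  let r := q + 1 in
  \sum_(s \in [set s | pd_le s p])
    ((-1) ^ ((pd_length s)%:Z - (pd_length p)%:Z) * r ^- pd_length s)
      *: Hbasis K s.

(* Main.v *)
(* A diagram p of order n has a cut at 0 < j < n when it is a product r * s with
   r of order j; the two factors are then the restrictions of p to the labels on
   each side of j, and whether the product is a tensor or a bullet is read off
   from the blocks of p crossing j. The cuts of a product are those of its
   factors together with the junction, so splitting at the last cut gives
   existence and uniqueness of the refinement, and splitting at the first tensor
   cut shows that l(p) - 1 is the number of tensor cuts. Hence a ~-class with n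
   factors is parametrised by the subsets A of {1, .., n-1}, with l = #|A| + 1 and
   with <= the reverse inclusion, and the claim is Moebius inversion in a Boolean
   lattice. *)
Require Import Defs.
From mathcomp Require Import all_boot all_order all_algebra.
From mathcomp Require Import zify.
From mathcomp Require Import boolp.

Set Implicit Arguments.
Unset Strict Implicit.
Unset Printing Implicit Defensive.

Local Open Scope set_scope.
Local Open Scope nat_scope.

(** * Diagrams as equivalence relations on labels *)

(* Labels of all diagrams live in [bool * nat] ([true] for the primed ones), so
   that diagrams of different orders can be compared without casts. *)
Definition lab k (x : 'I_k + 'I_k) : bool * nat :=
  match x with inl i => (false, val i) | inr i => (true, val i) end.

Definition shift a (x : bool * nat) : bool * nat := (x.1, a + x.2).

Definition pd_order (p : pdiag) : nat := tag p.

(** The block relation of [p], extended by false to labels beyond its order; it is therefore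
    reflexive only below the order. *)
Definition drel (p : pdiag) (x y : bool * nat) : bool :=
  let: existT k P := p in
  [exists u, exists v, [&& lab u == x, lab v == y & v \in pblock (val P) u]].

Lemma lab_inj k : injective (@lab k).
Proof. by move=> [i|i] [j|j] //= [] /val_inj->. Qed.

Lemma lab_lt k (x : 'I_k + 'I_k) : (lab x).2 < k.
Proof. by case: x => i /=. Qed.

Lemma lab_surj k x : x.2 < k -> exists u : 'I_k + 'I_k, lab u = x.
Proof.
case: x => -[] i /= ik; first by exists (inr (Ordinal ik)).
by exists (inl (Ordinal ik)).
Qed.

Lemma lab_lemb k m (u : 'I_k + 'I_k) : lab (lemb m u) = lab u.
Proof. by case: u. Qed.

Lemma lab_remb k m (u : 'I_m + 'I_m) : lab (remb k u) = shift k (lab u).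
Proof. by case: u. Qed.

Lemma drel_lab k (P : dgm_of k) u v :
  drel (Tagged dgm_of P) (lab u) (lab v) = (v \in pblock (val P) u).
Proof.
apply/existsP/idP => [[u' /existsP[v' /and3P[/eqP/lab_inj-> /eqP/lab_inj->]]]//|vu].
by exists u; apply/existsP; exists v; rewrite !eqxx.
Qed.

Lemma drel_lt p x y : drel p x y -> (x.2 < pd_order p) && (y.2 < pd_order p).
Proof.
case: p => k P /existsP[u /existsP[v /and3P[/eqP<- /eqP<- _]]].
by rewrite /pd_order /= !lab_lt.
Qed.

Lemma drel_outl p x y : pd_order p <= x.2 -> drel p x y = false.
Proof. by move=> px; apply/negP => /drel_lt; rewrite ltnNge px. Qed.

Lemma drel_outr p x y : pd_order p <= y.2 -> drel p x y = false.
Proof. by move=> py; apply/negP => /drel_lt; rewrite [y.2 < _]ltnNge py andbF. Qed.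

Lemma pblock_equiv k (P : dgm_of k) :
  [/\ forall u, u \in pblock (val P) u &
      forall u v, u \in pblock (val P) v -> pblock (val P) u = pblock (val P) v].
Proof.
have /and3P[/eqP cP tP _] := valP P; split=> [u|u v]; last exact: same_pblock.
by rewrite mem_pblock cP inE.
Qed.

Lemma drel_refl p x : x.2 < pd_order p -> drel p x x.
Proof.
case: p => k P /lab_surj[u <-]; rewrite (drel_lab P).
by case: (pblock_equiv P).
Qed.

Lemma drel_symW p x y : drel p x y -> drel p y x.
Proof.
move=> xy; have /andP[] := drel_lt xy; case: p xy => k P.
move=> + /lab_surj[u ux] /lab_surj[v vy].
rewrite -ux -vy !(drel_lab P); have [rP tP] := pblock_equiv P.
by move=> /tP->.
Qed.

Lemma drel_sym p x y : drel p x y = drel p y x.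
Proof. by apply/idP/idP => /drel_symW. Qed.

Lemma drel_trans p y x z : drel p x y -> drel p y z -> drel p x z.
Proof.
move=> xy yz; have /andP[] := drel_lt xy; have /andP[_] := drel_lt yz.
case: p xy yz => k P.
move=> + + /lab_surj[w wz] /lab_surj[u ux] /lab_surj[v vy].
rewrite -ux -vy -wz !(drel_lab P); have [rP tP] := pblock_equiv P.
by move=> /tP->.
Qed.

(** Extensionality for diagrams: a partition is recovered as the equivalence partition of its block
    relation. All later equalities of diagrams with possibly different orders go through this. *)
Lemma drel_inj p q : pd_order p = pd_order q ->
  (forall x y, drel p x y = drel q x y) -> p = q.
Proof.
case: p q => k P [m Q] km; have {km} : k = m := km.
move=> km; case: m / km Q => Q PQ.
congr existT; apply: val_inj.
rewrite -(equivalence_partition_pblock (valP P)).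
rewrite -(equivalence_partition_pblock (valP Q)).
apply: eq_imset => u; apply/setP => v; rewrite !inE /=.
by have := PQ (lab u) (lab v); rewrite (drel_lab P) (drel_lab Q).
Qed.

Lemma pd_order_eq0 p : ~~ (0 < pd_order p) -> p = pd0.
Proof.
rewrite lt0n negbK => /eqP p0; apply: drel_inj => // x y.
by rewrite !drel_outl // p0.
Qed.

Lemma pd_orderP p : reflect (p <> pd0) (0 < pd_order p).
Proof.
apply: (iffP idP) => [p0 pE|p0]; first by rewrite pE in p0.
by apply/contra_notT: p0; exact: pd_order_eq0.
Qed.

(** * Restriction to an interval of labels *)

(** The kernel of this map is the restricted relation, so its preimage partition is a diagram
    without further proof. *)
Definition restr_class (p : pdiag) a m (u : 'I_m + 'I_m) :=
  [set v : 'I_(pd_order p) + 'I_(pd_order p)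
     | drel p (shift a (lab u)) (lab v)].

Definition restr (p : pdiag) a m : pdiag :=
  Tagged dgm_of (exist _ (preim_partition (@restr_class p a m) setT)
                   (preim_partitionP (@restr_class p a m) setT) : dgm_of m).

(** The bound keeps shifted labels inside [p], so their classes are non-empty and two of them are
    equal exactly when the labels are related. *)
Lemma drel_restr p a m x y : a + m <= pd_order p ->
  drel (restr p a m) x y =
  [&& x.2 < m, y.2 < m & drel p (shift a x) (shift a y)].
Proof.
move=> amp.
have [xm|xm] := ltnP x.2 m; last by rewrite drel_outl.
have [ym|ym] := ltnP y.2 m; last by rewrite drel_outr.
have [u <-] := lab_surj xm; have [v <-] := lab_surj ym.
rewrite (drel_lab (exist _ _ _ : dgm_of m)) /=.
rewrite pblock_equivalence_partition //; last first.
  by move=> ? ? ? _ _ _; split=> // /eqP->.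
have up : (shift a (lab u)).2 < pd_order p by have := lab_lt u => /=; lia.
have vp : (shift a (lab v)).2 < pd_order p by have := lab_lt v => /=; lia.
apply/eqP/idP => [/setP uv|uv].
  have [w wv] := lab_surj vp; have := uv w.
  by rewrite !inE wv (drel_refl vp).
apply/setP => w; rewrite !inE; apply/idP/idP; apply: drel_trans => //.
by rewrite drel_sym.
Qed.

(** * Block relations of the two products *)

Lemma lemb_inj k m : injective (@lemb k m).
Proof. by move=> u v uv; apply: lab_inj; rewrite -(lab_lemb m u) uv lab_lemb. Qed.

Lemma remb_inj k m : injective (@remb k m).
Proof.
move=> u v /(congr1 (@lab _)); rewrite !lab_remb => -[u1 /addnI u2].
by apply: lab_inj; rewrite [LHS]surjective_pairing u1 u2 -surjective_pairing.
Qed.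

Lemma lemb_remb k m (u : 'I_k + 'I_k) (v : 'I_m + 'I_m) :
  lemb m u <> remb k v.
Proof.
move=> /(congr1 (@lab _)); rewrite lab_lemb lab_remb => uv.
by have := lab_lt u; rewrite uv ltnNge leq_addr.
Qed.

Lemma pblock_tensl k m (P : dgm_of k) (Q : dgm_of m) u :
  pblock (tens_blocks (val P) (val Q)) (lemb m u) = lemb m @: pblock (val P) u.
Proof.
apply: def_pblock.
- exact/partition_trivIset/(tens_blocks_partition (valP P) (valP Q)).
- apply/setUP; left; apply: imset_f; apply: pblock_mem.
  by rewrite (cover_partition (valP P)) inE.
- by apply: imset_f; have [] := pblock_equiv P.
Qed.

Lemma pblock_tensr k m (P : dgm_of k) (Q : dgm_of m) u :
  pblock (tens_blocks (val P) (val Q)) (remb k u) = remb k @: pblock (val Q) u.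
Proof.
apply: def_pblock.
- exact/partition_trivIset/(tens_blocks_partition (valP P) (valP Q)).
- apply/setUP; right; apply: imset_f; apply: pblock_mem.
  by rewrite (cover_partition (valP Q)) inE.
- by apply: imset_f; have [] := pblock_equiv Q.
Qed.

Lemma order_tens p q : pd_order (pd_tens p q) = pd_order p + pd_order q.
Proof. by case: p q => k P []. Qed.

Lemma tens_ll p q x y : x.2 < pd_order p -> y.2 < pd_order p ->
  drel (pd_tens p q) x y = drel p x y.
Proof.
case: p q => k P [m Q] /lab_surj[u <-] /lab_surj[v <-].
rewrite (drel_lab P) -(lab_lemb m u) -(lab_lemb m v) (drel_lab (exist _ _ _ : dgm_of (k + m))).
by rewrite /= pblock_tensl mem_imset //; exact: lemb_inj.
Qed.

Lemma tens_rr p q x y :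
  drel (pd_tens p q) (shift (pd_order p) x) (shift (pd_order p) y) = drel q x y.
Proof.
have [xq|xq] := ltnP x.2 (pd_order q); last first.
  by rewrite !drel_outl // order_tens /= leq_add2l.
have [yq|yq] := ltnP y.2 (pd_order q); last first.
  by rewrite !drel_outr // order_tens /= leq_add2l.
case: p q xq yq => k P [m Q] /lab_surj[u <-] /lab_surj[v <-].
rewrite (drel_lab Q) -!lab_remb (drel_lab (exist _ _ _ : dgm_of (k + m))).
by rewrite /= pblock_tensr mem_imset //; exact: remb_inj.
Qed.

Lemma tens_lr p q x y : x.2 < pd_order p ->
  drel (pd_tens p q) x (shift (pd_order p) y) = false.
Proof.
have [yq|yq] := ltnP y.2 (pd_order q); last first.
  by rewrite !drel_outr // order_tens /= leq_add2l.
case: p q yq => k P [m Q] /lab_surj[v <-] /lab_surj[u <-].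
rewrite -lab_remb -(lab_lemb m) (drel_lab (exist _ _ _ : dgm_of (k + m))).
by rewrite /= pblock_tensl; apply/imsetP => -[w _] /esym/lemb_remb.
Qed.

Lemma mem_merge_blocks (T : finType) (P : {set {set T}}) x y u v :
  partition P setT ->
  (v \in pblock (merge_blocks P x y) u) =
  (v \in pblock P u) ||
  (u \in pblock P x :|: pblock P y) && (v \in pblock P x :|: pblock P y).
Proof.
move=> pP; set X := pblock P x; set Y := pblock P y.
have pM : partition (merge_blocks P x y) setT by apply: merge_blocks_partition.
have tM := partition_trivIset pM; have tP := partition_trivIset pP.
have uP : u \in pblock P u by rewrite mem_pblock (cover_partition pP).
have [uXY|] := boolP (u \in X :|: Y).
  rewrite (def_pblock tM _ uXY) /=; last by rewrite /merge_blocks !inE eqxx.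
  rewrite orbC; case: (boolP (v \in _)) => //= vXY; apply/esym/negP => vu.
  by case/setUP: uXY => uX; move: vXY; rewrite inE /X /Y -(same_pblock tP uX) vu ?orbT.
rewrite inE negb_or => /andP[uX uY]; rewrite orbF.
rewrite (def_pblock tM _ uP) // /merge_blocks !inE.
rewrite pblock_mem ?(cover_partition pP) ?inE // andbT.
have -> : pblock P u != Y by apply: contraNneq uY => <-.
have -> : pblock P u != X by apply: contraNneq uX => <-.
by rewrite orbT.
Qed.

Lemma order_bullet p q : pd_order (pd_bullet p q) = pd_order p + pd_order q.
Proof. by case: p q => -[|k] P [[|m] Q] //=; rewrite addn0. Qed.

(** With labels counted from 0, [z] is the last primed label of [p] and [t] the first primed label
    of [q]; merging their blocks adds exactly the pairs inside the union of these blocks. *)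
Lemma drel_bullet p q x y (z := (true, (pd_order p).-1))
    (t := (true, pd_order p)) :
  0 < pd_order p -> 0 < pd_order q ->
  drel (pd_bullet p q) x y = drel (pd_tens p q) x y ||
    (drel (pd_tens p q) z x || drel (pd_tens p q) t x) &&
    (drel (pd_tens p q) z y || drel (pd_tens p q) t y).
Proof.
have [xpq p0 q0|xpq _ _] := ltnP x.2 (pd_order p + pd_order q); last first.
  rewrite drel_outl ?order_bullet // drel_outl ?order_tens //.
  by rewrite !(drel_outr _ (y := x)) ?order_tens.
have [ypq|ypq] := ltnP y.2 (pd_order p + pd_order q); last first.
  rewrite drel_outr ?order_bullet // drel_outr ?order_tens //.
  by rewrite !(drel_outr _ (y := y)) ?order_tens ?andbF.
case: p q p0 q0 xpq ypq @z @t => -[|k] P [[|m] Q] // _ _.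
move=> /lab_surj[u <-] /lab_surj[v <-].
rewrite (drel_lab (exist _ _ _ : dgm_of (k.+1 + m.+1))) /= /bullet_blocks.
rewrite mem_merge_blocks; last exact: tens_blocks_partition (valP P) (valP Q).
have -> : (true, k) = lab (inr (lshift m.+1 (@ord_max k))) by [].
have -> : (true, k.+1) = lab (inr (rshift k.+1 (@ord0 m))).
  by rewrite /= addn0.
rewrite !inE.
have TE a b : (b \in pblock (tens_blocks (val P) (val Q)) a) =
    drel (pd_tens (Tagged dgm_of P) (Tagged dgm_of Q)) (lab a) (lab b).
  by rewrite (drel_lab (exist _ _ _ : dgm_of (k.+1 + m.+1))).
by rewrite !TE.
Qed.

Definition op (b : bool) (p q : pdiag) := if b then pd_tens p q else pd_bullet p q.

Lemma order_op b p q : pd_order (op b p q) = pd_order p + pd_order q.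
Proof. by case: b; rewrite ?order_tens ?order_bullet. Qed.

Section Op.
Variables (p q : pdiag).
Hypotheses (p0 : 0 < pd_order p) (q0 : 0 < pd_order q).
Notation k := (pd_order p).

Let tE : (true, k) = shift k (true, 0).
Proof. by rewrite /shift addn0. Qed.

Let zk : (true, k.-1).2 < k.
Proof. by rewrite /= ltn_predL. Qed.

(** On the left side the merged block contains only the block of the last primed label of [p], so
    merging relates nothing new there. *)
Lemma op_ll b x y : x.2 < k -> y.2 < k -> drel (op b p q) x y = drel p x y.
Proof.
move=> xk yk; case: b => /=; first exact: tens_ll.
rewrite drel_bullet // tE ![drel _ (shift _ _) _]drel_sym !tens_lr // !orbF.
rewrite !tens_ll ?prednK //= ?ltn_predL //.
apply: orb_idr => /andP[zx zy]; apply: drel_trans zy.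
by rewrite drel_sym.
Qed.

Lemma op_rr b x y : drel (op b p q) (shift k x) (shift k y) = drel q x y.
Proof.
case: b => /=; first exact: tens_rr.
rewrite drel_bullet // tE !(tens_lr _ _ zk) !tens_rr !orFb.
apply: orb_idr => /andP[zx zy]; apply: drel_trans zy.
by rewrite drel_sym.
Qed.

(** The merged block is the only one that can cross the junction. This formula is the model for the
    definition of [cut]. *)
Lemma op_lr b x y : x.2 < k ->
  drel (op b p q) x (shift k y) =
  [&& ~~ b, drel p x (true, k.-1) & drel q (true, 0) y].
Proof.
move=> xk; case: b => /=; first exact: tens_lr.
rewrite drel_bullet // tE (tens_lr _ _ zk) (tens_lr _ _ xk) !tens_rr !orFb.
rewrite tens_ll // [drel _ (shift _ _) x]drel_sym tens_lr // orbF.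
by rewrite drel_sym.
Qed.

End Op.

(** * Cuts and their behaviour under products *)

Lemma order_restr p a m : pd_order (restr p a m) = m.
Proof. by []. Qed.

Lemma shift_subK k x : k <= x.2 -> shift k (x.1, x.2 - k) = x.
Proof. by case: x => e i /= ki; rewrite /shift /= subnKC. Qed.

(* [cut b p j] says that [p = op b r s] for some [r] of order [j]: the blocks
   crossing [j] are none if [b] and exactly the common block of the primed
   labels on both sides of [j] otherwise. *)
Definition cut (b : bool) (p : pdiag) (j : nat) : Prop :=
  0 < j < pd_order p /\
  forall x y, x.2 < j <= y.2 ->
    drel p x y = [&& ~~ b, drel p x (true, j.-1) & drel p (true, j) y].

Section CutOp.
Variables (p q : pdiag) (b : bool).
Hypotheses (p0 : 0 < pd_order p) (q0 : 0 < pd_order q).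
Notation k := (pd_order p).

Let tE : (true, k) = shift k (true, 0).
Proof. by rewrite /shift addn0. Qed.

(** The two primed labels next to the junction are related exactly for the bullet product, so this
    one pair reveals the type of the cut. *)
Lemma cut_op c : cut c (op b p q) k <-> c = b.
Proof.
have zk : (true, k.-1).2 < k by rewrite /= ltn_predL.
split=> [[_ /(_ (true, k.-1) (true, k))]|->].
  rewrite tE (op_lr _ _ _ _ zk) // (op_ll _ _ _ zk zk) // op_rr //.
  rewrite (drel_refl zk) (drel_refl (x := (true, 0)) q0) !andbT.
  by move=> bc; apply/negb_inj/esym/bc => /=; lia.
split=> [|x y /andP[xk ky]]; first by rewrite order_op; lia.
by rewrite -(shift_subK ky) tE op_lr // op_ll ?ltn_predL // op_rr.
Qed.

Lemma cut_opl c j : j < k -> cut c (op b p q) j <-> cut c p j.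
Proof.
move=> jk; split=> -[/andP[j0 _] H]; split; rewrite ?order_op; try lia.
  move=> x y xjy; have [yk|yk] := ltnP y.2 k; last by rewrite !(drel_outr _ yk) !andbF.
  by have := H x y xjy; rewrite !op_ll //=; lia.
move=> x y xjy; have [yk|yk] := ltnP y.2 k.
  by rewrite !op_ll //=; [exact: H | lia..].
(* A label beyond the junction is reached only through the last primed label of [p], which is itself
   right of [j], so the cut condition of [p] applies there. *)
rewrite -(shift_subK yk) !op_lr //=; try lia.
rewrite op_ll /=; try lia.
rewrite (H x (true, k.-1)) /=; last by lia.
by case: (b); case: (c); rewrite ?andbF //= andbA.
Qed.

Lemma cut_opr c j : 0 < j -> cut c (op b p q) (k + j) <-> cut c q j.
Proof.
move=> j0; rewrite /cut order_op.
have jE : (true, (k + j).-1) = shift k (true, j.-1).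
  by rewrite /shift /= -(prednK j0) addnS.
rewrite jE -/(shift k (true, j)).
split=> -[/andP[_ jq] H]; split; try lia.
  move=> x y xjy; have := H (shift k x) (shift k y).
  by rewrite !op_rr //; apply; rewrite /= ltn_add2l leq_add2l.
move=> x y /andP[xj jy].
have ky : k <= y.2 by lia.
rewrite -(shift_subK ky).
(* For [x] in [p] the crossing goes through the first primed label of [q], which lies left of the
   cut since [0 < j]. *)
have [xk|xk] := ltnP x.2 k.
  rewrite !(op_lr _ _ _ _ xk) // !op_rr // (H (true, 0)) /=; last by lia.
  by case: (b); case: (c); rewrite ?andbF //= andbA.
by rewrite -(shift_subK xk) !op_rr //; apply: H => /=; lia.
Qed.

End CutOp.

(** The restrictions fix the pairs on either side of [j], and the cut condition prescribes the
    crossing pairs just as [op_lr] does for the product. *)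
Lemma cutE b p j : cut b p j ->
  p = op b (restr p 0 j) (restr p j (pd_order p - j)).
Proof.
move=> [/andP[j0 jp] H].
have d0 x y : drel (restr p 0 j) x y = [&& x.2 < j, y.2 < j & drel p x y].
  rewrite drel_restr /=; last by lia.
  by case: x y => [? ?] [].
have dj x y : drel (restr p j (pd_order p - j)) x y =
              drel p (shift j x) (shift j y).
  rewrite drel_restr; last by lia.
  apply/and3P/idP => [[]//|xy]; split=> //; have := drel_lt xy => /=; lia.
set P := restr p 0 j in d0 *; set Q := restr p j _ in dj *.
have Pj : pd_order P = j by [].
have Qj : pd_order Q = pd_order p - j by [].
have P0 : 0 < pd_order P by rewrite Pj.
have Q0 : 0 < pd_order Q by rewrite Qj; lia.
have lr x y : x.2 < j -> drel p x (shift j y) = drel (op b P Q) x (shift j y).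
  move=> xj; have xP : x.2 < pd_order P by [].
  rewrite -[in RHS]Pj (op_lr _ _ _ _ xP) // d0 dj xj /= [_ < j]ltn_predL j0 /=.
  by rewrite H /= ?leq_addr ?xj // /shift /= addn0.
apply: drel_inj => [|x y]; first by rewrite order_op Pj Qj; lia.
have [xj|xj] := ltnP x.2 j; have [yj|yj] := ltnP y.2 j.
- by rewrite op_ll ?Pj // d0 xj yj.
- by rewrite -(shift_subK yj) lr.
- by rewrite -(shift_subK xj) drel_sym lr // drel_sym.
- by rewrite -(shift_subK yj) -(shift_subK xj) -[in RHS]Pj op_rr // dj.
Qed.

Lemma irreducibleP b p :
  (~ exists r s, [/\ r <> pd0, s <> pd0 & p = op b r s]) <->
  forall j, ~ cut b p j.
Proof.
split=> [irr j pj|nocut [r [s [/pd_orderP r0 /pd_orderP s0 pE]]]].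
  have [/andP[j0 jp] _] := pj.
  apply: irr; exists (restr p 0 j), (restr p j (pd_order p - j)).
  by split; [apply/pd_orderP..|exact: cutE]; rewrite order_restr //; lia.
by apply: (nocut (pd_order r)); rewrite pE; apply/cut_op.
Qed.

(** * Uniqueness and existence of the refinement *)

Definition atom (p : pdiag) : Prop :=
  0 < pd_order p /\ forall b j, ~ cut b p j.

Lemma atomP p :
  [/\ p <> pd0, tens_irreducible p & bullet_irreducible p] <-> atom p.
Proof.
split=> [[/pd_orderP p0 ti bi]|[p0 nocut]].
  by split=> // -[]; apply/irreducibleP.
split; first exact/pd_orderP.
- exact/(irreducibleP true).
- exact/(irreducibleP false).
Qed.

(** If the junctions differed, the earlier one would be a proper cut of the product and the later
    one would leave a cut inside the longer last atom. Once the junctions agree, the cut there gives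
    the type and the relations on each side give the factors. *)
Lemma op_atom_inj b b' P P' q q' :
  0 < pd_order P -> 0 < pd_order P' -> atom q -> atom q' ->
  op b P q = op b' P' q' -> [/\ b = b', P = P' & q = q'].
Proof.
move=> P0 P0' [q0 nq] [q0' nq'] E.
have sumE : pd_order P + pd_order q = pd_order P' + pd_order q'.
  by rewrite -!(order_op b) E !order_op.
have oP : pd_order P = pd_order P'.
  have [lt|lt|//] := ltngtP (pd_order P) (pd_order P').
  - exfalso; apply: (nq b' (pd_order P' - pd_order P)).
    apply/(cut_opr b P0); rewrite ?subn_gt0 // subnKC ?(ltnW lt) // E.
    exact/cut_op.
  - exfalso; apply: (nq' b (pd_order P - pd_order P')).
    apply/(cut_opr b' P0'); rewrite ?subn_gt0 // subnKC ?(ltnW lt) // -E.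
    exact/cut_op.
have bb : b = b'.
  by apply/(cut_op b' P0' q0'); rewrite -E -oP; apply/cut_op.
split=> //; apply: drel_inj => //; try by lia.
- move=> x y; have [xP|xP] := ltnP x.2 (pd_order P); last first.
    by rewrite !drel_outl -?oP.
  have [yP|yP] := ltnP y.2 (pd_order P); last by rewrite !drel_outr -?oP.
  by rewrite -(op_ll P0 q0 b) // E op_ll -?oP.
- by move=> x y; rewrite -(op_rr P0 q0 b) E oP op_rr.
Qed.

Definition wf_product (w : mixed_product) : Prop :=
  forall f, f \in mixed_factors w -> atom f.

Lemma mixed_eval_rcons a l b q :
  mixed_eval (a, rcons l (b, q)) = op b (mixed_eval (a, l)) q.
Proof. by rewrite /mixed_eval foldl_rcons. Qed.

Lemma wf_product_rcons a l b q :
  wf_product (a, rcons l (b, q)) <-> wf_product (a, l) /\ atom q.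
Proof.
rewrite /wf_product /mixed_factors /= map_rcons -rcons_cons; split=> [H|[H aq] f].
  by split=> [f fl|]; apply: H; rewrite mem_rcons inE ?fl ?orbT ?eqxx.
by rewrite mem_rcons inE => /orP[/eqP->|/H].
Qed.

Lemma mixed_eval_order w : wf_product w -> 0 < pd_order (mixed_eval w).
Proof.
case: w => a l; elim/last_ind: l => [|l [b q] IH].
  by move=> /(_ a); rewrite inE eqxx => /(_ isT)[].
by move=> /wf_product_rcons[/IH a0 _]; rewrite mixed_eval_rcons order_op addn_gt0 a0.
Qed.

Lemma mixed_eval_inj w w' : wf_product w -> wf_product w' ->
  mixed_eval w = mixed_eval w' -> w = w'.
Proof.
(* A single atom is never a longer product, whose last junction is a cut. *)
have nil_rcons a a' l b q : wf_product (a, [::]) ->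
    wf_product (a', rcons l (b, q)) -> a <> mixed_eval (a', rcons l (b, q)).
  move=> /(_ a); rewrite inE eqxx => /(_ isT)[_ na].
  move=> /wf_product_rcons[/mixed_eval_order w0 [q0 _]] E.
  by apply: (na b (pd_order (mixed_eval (a', l)))); rewrite E mixed_eval_rcons; apply/cut_op.
case: w w' => a l [a' l'].
elim/last_ind: l l' => [|l [b q] IH] l'; case/lastP: l' => [|l' [b' q']].
- by move=> _ _; rewrite /mixed_eval /= => ->.
- by move=> wa wa' /(nil_rcons _ _ _ _ _ wa wa').
- by move=> wa wa' /esym/(nil_rcons _ _ _ _ _ wa' wa).
move=> /wf_product_rcons[wa aq] /wf_product_rcons[wa' aq'].
rewrite !mixed_eval_rcons.
case/(op_atom_inj (mixed_eval_order wa) (mixed_eval_order wa') aq aq').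
by move=> -> /(IH _ wa wa')[-> ->] ->.
Qed.

Lemma mixed_eval_surj p : 0 < pd_order p ->
  exists2 w, wf_product w & p = mixed_eval w.
Proof.
have [n] := ubnP (pd_order p); elim: n p => // n IH p pn p0.
pose C j := `[< exists b, cut b p j >].
have [exC|noC] := pselect (exists j, C j); last first.
  exists (p, [::]) => // f; rewrite inE => /eqP->; split=> // b j pj.
  by apply: noC; exists j; apply/asboolP; exists b.
have Cle j : C j -> j <= pd_order p by move=> /asboolP[b [/andP[_ /ltnW]]].
(* At the last cut of either type the right factor is an atom: a cut of it at [i] would be a cut of
   [p] at [j + i]. *)
case: (ex_maxnP exC Cle) => j /asboolP[b pj] jmax.
have [/andP[j0 jp] _] := pj; have pE := cutE pj.
set r := restr p 0 j in pE; set s := restr p j _ in pE.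
have rj : pd_order r = j by [].
have s0 : 0 < pd_order s by rewrite order_restr; lia.
have [||[a l] wa rE] := IH r; [by rewrite rj; lia|by rewrite rj|].
exists (a, rcons l (b, s)); last by rewrite mixed_eval_rcons -rE.
apply/wf_product_rcons; split=> //; split=> // c i si.
have i0 : 0 < i by case: si => /andP[].
suff /jmax : C (j + i) by lia.
by apply/asboolP; exists c; rewrite pE -rj; apply/cut_opr => //; rewrite rj.
Qed.

Lemma is_refinementP p w : is_refinement p w <-> wf_product w /\ p = mixed_eval w.
Proof. by split=> -[H ->]; split=> // f /H /atomP. Qed.

(** * Counting tensor cuts and tensor factors *)

Definition ncut (p : pdiag) : nat :=
  count (fun j => `[< cut true p j >]) (iota 0 (pd_order p)).

Lemma ncut_op b p q : 0 < pd_order p -> 0 < pd_order q ->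
  ncut (op b p q) = ncut p + b + ncut q.
Proof.
move=> p0 q0; rewrite /ncut order_op iotaD count_cat add0n -addnA.
congr (_ + _).
  apply: eq_in_count => j; rewrite mem_iota => /= jp.
  by apply/asboolP/asboolP => /cut_opl; apply.
rewrite -[in iota _ _](addn0 (pd_order p)) iotaDl count_map.
(* Position 0 of [q], never a cut of [q], becomes the junction, which contributes [b]. *)
have q1 := prednK q0; rewrite -[in LHS]q1 -[in RHS]q1 /=.
have -> : `[< cut true q 0 >] = false by apply/asboolP => -[].
have -> : `[< cut true (op b p q) (pd_order p + 0) >] = b.
  by rewrite addn0; apply/asboolP/idP => [/cut_op <-|->] //; apply/cut_op.
rewrite add0n; congr (_ + _); apply: eq_in_count => j.
rewrite mem_iota /= => /andP[j0 _].
by apply/asboolP/asboolP => /cut_opr; apply.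
Qed.

Lemma ncut0 p : (forall j, ~ cut true p j) -> ncut p = 0.
Proof.
move=> nocut; rewrite /ncut (eq_count (a2 := pred0)) ?count_pred0 // => j.
by apply/asboolP => /nocut.
Qed.

Lemma tens_pd0 p : pd_tens p pd0 = p.
Proof.
apply: drel_inj => [|x y]; first by rewrite order_tens addn0.
have [xp|xp] := ltnP x.2 (pd_order p); last first.
  by rewrite !drel_outl // order_tens addn0.
have [yp|yp] := ltnP y.2 (pd_order p); last first.
  by rewrite !drel_outr // order_tens addn0.
by rewrite tens_ll.
Qed.

(** Each factor is free of tensor cuts and each junction is one. Hence all factorizations have the
    same size, and the one chosen in [pd_length] does not matter. *)
Lemma size_tens_factorization p s : is_tens_factorization p s ->
  size s = if 0 < pd_order p then (ncut p).+1 else 0.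
Proof.
elim: s p => [|f s IH] p [irr ->] //=.
have [f0 nf] : 0 < pd_order f /\ forall j, ~ cut true f j.
  have [|/pd_orderP f0 fi] := irr f; first by rewrite inE eqxx.
  by split=> //; apply/(irreducibleP true).
have {}IH : size s = if 0 < pd_order (foldr pd_tens pd0 s)
    then (ncut (foldr pd_tens pd0 s)).+1 else 0.
  by apply: IH; split=> // g gs; apply: irr; rewrite inE gs orbT.
rewrite order_tens addn_gt0 f0 /= IH; case: ifPn => [s0|].
  by rewrite (ncut_op true) // (ncut0 nf).
by move=> /pd_order_eq0->; rewrite tens_pd0 ncut0.
Qed.

Lemma tens_factorization_exists p : exists s, is_tens_factorization p s.
Proof.
have [n] := ubnP (pd_order p); elim: n p => // n IH p pn.
have [p0|/pd_order_eq0->] := boolP (0 < pd_order p); last by exists [::].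
have [exC|noC] := pselect (exists j, `[< cut true p j >]); last first.
  exists [:: p]; split=> [f|]; last by rewrite /= tens_pd0.
  rewrite inE => /eqP->; split; first exact/pd_orderP.
  by apply/(irreducibleP true) => j pj; apply: noC; exists j; apply/asboolP.
(* The first tensor cut makes the left factor irreducible, since a tensor cut of it is an earlier
   one of [p]. *)
case: (ex_minnP exC) => j /asboolP pj jmin.
have [/andP[j0 jp] _] := pj; have pE := cutE pj.
set r := restr p 0 j in pE; set s := restr p j _ in pE.
have rj : pd_order r = j by [].
have s0 : 0 < pd_order s by rewrite order_restr; lia.
have [|l [lirr lE]] := IH s; first by rewrite order_restr; lia.
exists (r :: l); split=> [f|]; last by rewrite /= -lE.
rewrite inE => /orP[/eqP->|/lirr //]; split; first by apply/pd_orderP; rewrite rj.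
apply/(irreducibleP true) => i ri.
have ij : i < j by case: ri => /andP[_]; rewrite rj.
suff /jmin : `[< cut true p i >] by lia.
by apply/asboolP; rewrite pE; apply/cut_opl => //; rewrite ?rj.
Qed.

Lemma ncut_mixed_eval w : wf_product w ->
  ncut (mixed_eval w) = count id [seq bq.1 | bq <- w.2].
Proof.
case: w => a l; elim/last_ind: l => [|l [b q] IH].
  by move=> /(_ a); rewrite inE eqxx => /(_ isT)[_ na]; rewrite /= ncut0.
move=> /wf_product_rcons[wa [q0 nq]]; rewrite mixed_eval_rcons.
rewrite ncut_op ?mixed_eval_order // IH // (ncut0 (nq true)) addn0.
by rewrite map_rcons -cats1 count_cat /= addn0.
Qed.

(* Imported only here because classical_sets shadows the notations and lemmas of
   finset. *)
From mathcomp Require Import classical_sets fsbigop.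
From mathcomp Require Import monalg.
Import GRing.Theory.
Local Open Scope classical_set_scope.
Local Open Scope nat_scope.

(** * The chosen refinement and the length *)

Lemma refinement_mixed_eval w : wf_product w -> refinement (mixed_eval w) = w.
Proof.
move=> ww; apply: xget_unique => [|w' /is_refinementP[ww' /esym]].
  exact/is_refinementP.
exact: mixed_eval_inj.
Qed.

Lemma refinementP p : p <> pd0 ->
  wf_product (refinement p) /\ p = mixed_eval (refinement p).
Proof.
move=> /pd_orderP/mixed_eval_surj[w ww ->].
by rewrite refinement_mixed_eval.
Qed.

Lemma pd_length_pd0 : pd_length pd0 = 0.
Proof.
by have /size_tens_factorization := xgetPex [::] (tens_factorization_exists pd0).
Qed.

Lemma pd_length_mixed_eval w : wf_product w ->
  pd_length (mixed_eval w) = (count id [seq bq.1 | bq <- w.2]).+1.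
Proof.
move=> ww; set p := mixed_eval w.
have /size_tens_factorization := xgetPex [::] (tens_factorization_exists p).
by rewrite mixed_eval_order // ncut_mixed_eval.
Qed.

(** * Subsets parametrising an equivalence class *)

Lemma map_mem_nth m (bs : seq bool) : size bs = m ->
  [seq i \in [set j : 'I_m | nth false bs j]%SET | i <- enum 'I_m] = bs.
Proof.
move=> bsm; under eq_map do rewrite inE.
by rewrite (map_comp (nth false bs) val) val_enum_ord map_nth_iota0 -bsm ?take_size.
Qed.

Lemma nth_map_mem m (A : {set 'I_m}) (i : 'I_m) :
  nth false [seq j \in A | j <- enum 'I_m] i = (i \in A).
Proof. by rewrite (nth_map i) ?size_enum_ord // nth_ord_enum. Qed.

Lemma count_map_mem m (A : {set 'I_m}) :
  count id [seq j \in A | j <- enum 'I_m] = #|A|.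
Proof. by rewrite -sum1_count big_map big_enum_cond sum1_card. Qed.

Lemma size_map_mem m (A : {set 'I_m}) : size [seq j \in A | j <- enum 'I_m] = m.
Proof. by rewrite size_map size_enum_ord. Qed.

Section Class.
Variable w : mixed_product.
Hypothesis ww : wf_product w.
Notation m := (size w.2).

(** The product with the factors of [w] whose tensor positions, counted from 0, form [A]. *)
Definition with_ops (A : {set 'I_m}) : mixed_product :=
  (w.1, zip [seq i \in A | i <- enum 'I_m] [seq bq.2 | bq <- w.2]).

Lemma ops_with_ops A :
  [seq bq.1 | bq <- (with_ops A).2] = [seq i \in A | i <- enum 'I_m].
Proof. by rewrite -/(unzip1 _) unzip1_zip // size_map_mem size_map. Qed.

Lemma factors_with_ops A : mixed_factors (with_ops A) = mixed_factors w.
Proof.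
rewrite /mixed_factors /=; congr (_ :: _).
by rewrite -/(unzip2 _) unzip2_zip // size_map_mem size_map.
Qed.

Lemma wf_with_ops A : wf_product (with_ops A).
Proof. by move=> f; rewrite factors_with_ops; exact: ww. Qed.

Lemma with_ops_surj w' : mixed_factors w' = mixed_factors w ->
  exists A, w' = with_ops A.
Proof.
case: w' => a l [/= aw lw].
have sl : size l = m by have := congr1 size lw; rewrite !size_map.
exists [set j : 'I_m | nth false (unzip1 l) j]%SET.
rewrite /with_ops map_mem_nth ?size_map // -lw aw.
by rewrite -/(unzip2 _) zip_unzip.
Qed.

Definition of_ops A : pdiag := mixed_eval (with_ops A).

Lemma refinement_of_ops A : refinement (of_ops A) = with_ops A.
Proof. exact/refinement_mixed_eval/wf_with_ops. Qed.

Lemma of_ops_neq0 A : of_ops A <> pd0.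
Proof. exact/pd_orderP/mixed_eval_order/wf_with_ops. Qed.

Lemma of_ops_inj : injective of_ops.
Proof.
move=> A B /(congr1 refinement); rewrite !refinement_of_ops => AB.
by apply/setP => i; rewrite -!nth_map_mem -!ops_with_ops AB.
Qed.

Lemma pd_length_of_ops A : pd_length (of_ops A) = #|A|.+1.
Proof.
by rewrite pd_length_mixed_eval ?ops_with_ops ?count_map_mem //; exact: wf_with_ops.
Qed.

Lemma pd_le_of_ops A B : pd_le (of_ops A) (of_ops B) <-> B \subset A.
Proof.
have nA := @of_ops_neq0 A; have nB := @of_ops_neq0 B.
rewrite /pd_le /pd_sim /tens_positions !refinement_of_ops !factors_with_ops.
rewrite !ops_with_ops !size_map_mem.
split=> [[[]//|[_ _ _ BA]]|/fintype.subsetP BA].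
  (* The shift by one is due to [tens_positions] counting from 1. *)
  apply/fintype.subsetP => i iB; have := BA i.+1 => /=.
  by rewrite !nth_map_mem ltn_ord iB => -[].
right; split=> // -[//|i] [/= im iB]; split=> //; move: iB.
by rewrite -[i]/(val (Ordinal im)) !nth_map_mem => /BA.
Qed.

Lemma pd_le_of_opsW p B : pd_le p (of_ops B) -> exists A, p = of_ops A.
Proof.
case=> [[_ /of_ops_neq0]//|[/refinementP[wp pE] _ + _]].
rewrite /pd_sim refinement_of_ops factors_with_ops => /with_ops_surj[A wA].
by exists A; rewrite pE wA.
Qed.

(** Trades the finitely supported sum over diagrams for a sum over supersets of [B]: everything
    below [of_ops B] lies in its class, and [of_ops] is injective. *)
Lemma sum_pd_le (V : nmodType) (F : pdiag -> V) B :
  (\sum_(s \in [set s | pd_le s (of_ops B)]) F s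
   = \sum_(A : {set 'I_m} | B \subset A) F (of_ops A))%R.
Proof.
pose r := [seq of_ops A | A <- enum [pred A : {set 'I_m} | B \subset A]].
transitivity (\sum_(s <- r) F s)%R; last by rewrite big_map big_enum.
have ur : uniq r.
  by rewrite (map_inj_uniq of_ops_inj) enum_uniq.
apply: fsbig_fwiden => // s.
  move=> sB; have [A sA] := pd_le_of_opsW sB.
  rewrite sA in sB *; apply: map_f; rewrite mem_enum.
  exact/pd_le_of_ops.
by case=> /mapP[A]; rewrite mem_enum => /pd_le_of_ops BA ->.
Qed.

End Class.

Lemma of_opsE p : p <> pd0 ->
  exists w (B : {set 'I_(size w.2)}), wf_product w /\ p = of_ops B.
Proof.
move=> /refinementP[wp pE]; exists (refinement p).
have [B wB] := with_ops_surj (erefl (mixed_factors (refinement p))).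
by exists B; split=> //; rewrite /of_ops -wB.
Qed.

(** * Moebius inversion over subsets *)

Local Open Scope ring_scope.

Lemma sum_interval_sign (R : comNzRingType) (T : finType) (B C : {set T}) :
  \sum_(A : {set T} | (B \subset A) && (A \subset C)) (-1) ^+ #|C :\: A|
  = (B == C)%:R :> R.
Proof.
(* The signed sum is the expansion of a product over points: [F i] is the weight of [i] in [A],
   [G i] that of [i] outside [A]. Each factor [F i + G i] is 1 where [B] and [C] agree and 0 where
   they differ. *)
pose F (i : T) : R := (i \in C)%:R.
pose G (i : T) : R := if i \in B then 0 else if i \in C then -1 else 1.
have -> : (B == C)%:R = \prod_i (F i + G i).
  have [BC|nBC] := eqVneq B C.
    by rewrite big1 // => i _; rewrite /F /G -BC; case: (i \in B); rewrite ?addr0 ?add0r.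
  have [i iBC] : exists i, (i \in B) != (i \in C).
    apply/existsP; apply: contraNT nBC; rewrite negb_exists => /forallP H.
    by apply/eqP/setP => i; apply/eqP; rewrite -[_ == _]negbK.
  rewrite (bigD1 i) //= [F i + _](_ : _ = 0) ?mul0r // /F /G.
  by case: (i \in B) (i \in C) iBC => -[] //= _; rewrite ?addr0 ?subrr.
rewrite bigA_distr /= big_mkcond; apply: eq_bigr => A _.
case: ifPn => [/andP[/fintype.subsetP BA /fintype.subsetP AC]|].
  rewrite -prodr_const [LHS]big_mkcond; apply: eq_bigr => i _.
  rewrite /F /G !inE; case: ifPn => [/andP[iA iC]|].
    by rewrite (negbTE iA) iC ifN // (contraNN (BA i)).
  have [/AC->//|iA] := boolP (i \in A).
  by rewrite /= => /negbTE->; rewrite ifN // (contraNN (BA i)).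
rewrite negb_and => /orP[] /fintype.subsetPn[i iX iY]; rewrite (bigD1 i) //=.
  by rewrite (negbTE iY) /G iX mul0r.
by rewrite iX /F (negbTE iY) mul0r.
Qed.

(** As [C] contains [A], the integer difference of lengths is the natural number [#|C :\: A|]. *)
Lemma kappa_of_ops (K : fieldType) (q : K) w (A : {set 'I_(size w.2)}) :
  wf_product w ->
  kappa q (of_ops A) = \sum_(C : {set _} | A \subset C)
    ((-1) ^+ #|C :\: A| * (q + 1) ^- #|C|.+1) *: Hbasis K (of_ops C).
Proof.
move=> ww; rewrite /kappa sum_pd_le //; apply: eq_bigr => C AC.
rewrite !pd_length_of_ops // cardsD (finset.setIidPr AC).
by rewrite subzn ?ltnS ?subset_leq_card // subSS.
Qed.

Theorem proposition9p3 (K : fieldType) (r : K) (hr : r \is a GRing.unit)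
    (p : pdiag) :
  Hbasis K p =
  r ^+ pd_length p *: \sum_(s \in [set s | pd_le s p]) kappa (r - 1) s.
Proof.
have [->|/of_opsE[w [B [ww ->]]]] := pselect (p = pd0).
  have -> : [set s | pd_le s pd0] = [set pd0].
    by apply/seteqP; split=> s /=; [case=> [[]|[]]|left].
  rewrite fsbig_set1 /kappa.
  have -> : [set s | pd_le s pd0] = [set pd0].
    by apply/seteqP; split=> s /=; [case=> [[]|[]]|left].
  by rewrite fsbig_set1 pd_length_pd0 subrr expr0z invr1 mulr1 !scale1r.
rewrite sum_pd_le // pd_length_of_ops //.
under eq_bigr do rewrite kappa_of_ops // subrK.
(* After exchanging the sums, the coefficient of the basis vector of [C] contains the signed sum
   over all [A] between [B] and [C], which leaves only [C = B]. *)
rewrite (exchange_big_dep predT) //=.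
under eq_bigr do rewrite -scaler_suml -mulr_suml sum_interval_sign.
rewrite (bigD1 B) //= eqxx mul1r big1 ?addr0; last first.
  by move=> C; rewrite eq_sym => /negbTE->; rewrite mul0r scale0r.
by rewrite scalerA mulrV ?scale1r // unitrX.
Qed.
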